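(* Let $G$ be a simple connected graph. Then $G$ satisfies the delta conjecture, that is, for each $\mathbb{F}\in\{\mathbb{R},\mathbb{C}\}$, the minimum semidefinite rank of $G$ over $\mathbb{F}$ satisfies $$\operatorname{msr}(G)\le |G|-\delta(G).$$
   Context: All graphs are finite. A graph is simple if it has no loops or multiple edges. $|G|$ is the number of vertices of $G$, and $\delta(G)$ is the minimum degree of its vertices. For a graph $G$ with vertex set $\{1,\dots,n\}$, $S_+(G,\mathbb{F})$ denotes the set of all $n\times n$ positive semidefinite matrices $A=[a_{ij}]$, real symmetric if $\mathbb{F}=\mathbb{R}$ or complex Hermitian if $\mathbb{F}=\mathbb{C}$, such that for all $i\ne j$, $a_{ij}\ne 0$ if and only if $\{i,j\}$ is an edge of $G$; the diagonal entries play no role in determining the graph. The minimum semidefinite rank $\operatorname{msr}(G)$ (over $\mathbb{F}$) is the smallest possible rank of a matrix $A\in S_+(G,\mathbb{F})$. *)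

(* Defs.v *)
From HB Require Import structures.
From mathcomp Require Import all_boot all_order all_algebra.
From mathcomp Require Import boolp reals.
From mathcomp Require Import complex.

Set Implicit Arguments.
Unset Strict Implicit.
Unset Printing Implicit Defensive.
Import Order.TTheory GRing.Theory Num.Theory.
Local Open Scope ring_scope.

Record sgraph (n : nat) := SGraph {
  adj :> rel 'I_n;
  adj_sym : symmetric adj;
  adj_irr : irreflexive adj }.

(* The graph without vertices is not considered connected. *)
Definition connected_graph n (G : sgraph n) : Prop :=
  (0 < n)%N /\ forall i j : 'I_n, connect G i j.

Definition degree n (G : sgraph n) (i : 'I_n) : nat := #|[set j | G i j]|.

(* Every degree is less than n, so the default value n of the iterated
   minimum plays no role as soon as there is a vertex: see [min_degreeP]. *)
Definition min_degree n (G : sgraph n) : nat :=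
  \big[minn/n]_(i < n) degree G i.

Lemma min_degreeP n (G : sgraph n) : (0 < n)%N ->
  (exists i, degree G i = min_degree G) /\
  (forall i, (min_degree G <= degree G i)%N).
Proof.
move=> n_gt0.
have lb i : (min_degree G <= degree G i)%N.
  rewrite /min_degree; have := mem_index_enum i.
  elim: (index_enum _) => // a s IH; rewrite in_cons big_cons geq_min.
  by case/orP => [/eqP ->|/IH ->]; rewrite ?leqnn ?orbT.
split=> //; pose i0 := Ordinal n_gt0.
have deg_lt i : (degree G i < n)%N.
  have cardT : #|[set: 'I_n]| = n by rewrite cardsT card_ord.
  apply: (leq_trans _ (eq_leq cardT)); apply/proper_card/properP.
  by split; [exact: subsetT | exists i; rewrite ?inE ?adj_irr].
suff [//|E] : (exists i, degree G i = min_degree G) \/ min_degree G = n.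
  by have := leq_ltn_trans (lb i0) (deg_lt i0); rewrite E ltnn.
rewrite {2}/min_degree /min_degree.
elim/big_rec: _ => [|i m _ IH]; first by right.
left; case: (leqP (degree G i) m) => h; first by exists i.
case: IH => [//|mn]; by move: (ltn_trans h (deg_lt i)); rewrite mn ltnn.
Qed.

(* [theta] is the identity over the reals and the conjugation over the
   complex numbers.  In the latter case [0 <= z] says that z is real and
   nonnegative. *)
Definition psdmx (F : numFieldType) (theta : F -> F) n (A : 'M[F]_n) : Prop :=
  A \is hermitianmx n false theta /\
  forall x : 'cV[F]_n, 0 <= (map_mx theta x^T *m A *m x) 0 0.

Definition Splus (F : numFieldType) (theta : F -> F) n (G : sgraph n)
    (A : 'M[F]_n) : Prop :=
  psdmx theta A /\ forall i j : 'I_n, i != j -> (A i j != 0) = G i j.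

Definition Splus_rank (F : numFieldType) (theta : F -> F) n (G : sgraph n)
    (k : nat) : bool :=
  `[< exists A : 'M[F]_n, Splus theta G A /\ \rank A = k >].

(* The witness is the Gram matrix of the vertex-by-arc incidence matrix. *)
Lemma Splus_rank_ex (F : numFieldType) (theta : {rmorphism F -> F}) n
    (G : sgraph n) :
  (forall z, 0 <= theta z * z) -> exists k, Splus_rank theta G k.
Proof.
move=> theta_ge0.
pose b (i : 'I_n) (p : 'I_n * 'I_n) : nat :=
  (G p.1 p.2 * ((i == p.1) + (i == p.2)))%N.
pose B : 'M[F]_(n, #|{: 'I_n * 'I_n}|) := \matrix_(i, k) (b i (enum_val k))%:R.
have BE : map_mx theta B = B.
  by apply/matrixP => i k; rewrite !mxE rmorph_nat.
have BTE : map_mx theta B^T = B^T by rewrite -map_trmx BE.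
pose A := B *m B^T.
exists (\rank A); apply/asboolP; exists A; split=> //; split; first split.
- rewrite qualifE /= expr0 scale1r; apply/eqP.
  by rewrite /A trmx_mul trmxK map_mxM BE BTE.
- move=> x; rewrite /A mulmxA -mulmxA.
  have -> : map_mx theta x^T *m B = map_mx theta (B^T *m x)^T.
    by rewrite trmx_mul trmxK map_mxM BE.
  by rewrite !mxE sumr_ge0 // => k _; rewrite !mxE.
- move=> i j ij.
  have -> : A i j = (\sum_(k < #|{: 'I_n * 'I_n}|) b i (enum_val k) * b j (enum_val k))%N%:R.
    rewrite !mxE natr_sum; apply: eq_bigr => k _.
    by rewrite !mxE natrM.
  rewrite pnatr_eq0 sum_nat_eq0; apply/idP/idP.
    rewrite negb_forall => /existsP[k]; rewrite /b.
    case: (enum_val k) => u v /=.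
    case uv: (G u v) => //=; rewrite !mul1n.
    case: (eqVneq i u) => [eu|_]; case: (eqVneq i v) => [ev|_] //=;
      case: (eqVneq j u) => [fu|_]; case: (eqVneq j v) => [fv|_] //= _; subst;
      by rewrite ?eqxx // in ij *; rewrite // adj_sym.
  move=> Gij; rewrite negb_forall; apply/existsP; exists (enum_rank (i, j)).
  by rewrite enum_rankK /b /= Gij !eqxx !mul1n !addn1 -lt0n muln_gt0 add1n.
Qed.

Lemma Splus_rank_exR (R : realType) n (G : sgraph n) :
  exists k, Splus_rank (idfun : R -> R) G k.
Proof. by apply: Splus_rank_ex => z; rewrite /= -expr2 sqr_ge0. Qed.

Lemma Splus_rank_exC (R : realType) n (G : sgraph n) :
  exists k, Splus_rank (Num.conj : R[i] -> R[i]) G k.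
Proof. by apply: Splus_rank_ex => z; rewrite mulrC mul_conjC_ge0. Qed.

Definition msr_real (R : realType) n (G : sgraph n) : nat :=
  ex_minn (Splus_rank_exR R G).

Definition msr_complex (R : realType) n (G : sgraph n) : nat :=
  ex_minn (Splus_rank_exC R G).

(* Main.v *)
Require Import Defs.
From mathcomp Require Import all_boot all_order all_algebra.
From mathcomp Require Import reals complex.
From mathcomp Require Import all_fingroup ring.

(* Vectors f_j in dimension d = |G| - delta(G) are chosen one vertex after the
   other, f_j generic in the orthogonal complement of the earlier vectors f_i
   with i in N j, the earlier non-neighbors of j.  The order of the vertices is
   a maximum adjacency order: each vertex has, among the vertices not yet
   placed, the fewest non-neighbors among those already placed.  For such an
   order the cross Gram matrix of (f_i)_{i in A} and (f_j)_{j in B} has full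
   rank for generic f whenever A and B dominate the order (N j itself does),
   see [free_rep]; applied to N x together with an earlier neighbor p of x,
   this puts f_p outside the span of (f_i)_{i in N x}, whence f_x can be chosen
   non-orthogonal to f_p.

   Genericity is handled by joining two representations by a polynomial curve
   of representations: finitely many polynomial conditions, each satisfied by
   some representation, are satisfied simultaneously by a point of a curve. *)

Set Implicit Arguments.
Unset Strict Implicit.
Unset Printing Implicit Defensive.
Import Order.TTheory GRing.Theory Num.Theory.
Local Open Scope ring_scope.

(** * Cross Gram matrices of full rank *)

Section GramFree.
Variables (K : fieldType) (n : nat).
Implicit Types (A B C : {set 'I_n}).

(** The form is bilinear over any field, so a nonzero vector may be orthogonal to itself. For
    [A = B] this therefore asks more than independent rows: the form must be nondegenerate on their
    span. *)
Definition gram_free d A B (F : 'M[K]_(n, d)) : bool :=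
  row_free (mxsub (enum_val : 'I_#|A| -> 'I_n) (enum_val : 'I_#|B| -> 'I_n)
                  (F *m F^T)).

Definition supported_on A (z : 'rV[K]_n) := forall i, i \notin A -> z 0 i = 0.

Lemma sum_supported A (z : 'rV[K]_n) (h : 'I_n -> K) : supported_on A z ->
  \sum_i z 0 i * h i = \sum_(k < #|A|) z 0 (enum_val k) * h (enum_val k).
Proof.
move=> zA; rewrite -(big_enum_val (A := mem A) (fun i => z 0 i * h i)) /=.
rewrite [RHS]big_mkcond /=; apply: eq_bigr => i _.
by case: ifP => // /negbT /zA ->; rewrite mul0r.
Qed.

Lemma gram_freeP d A B (F : 'M[K]_(n, d)) :
  reflect (forall z, supported_on A z ->
             (forall j, j \in B -> (z *m (F *m F^T)) 0 j = 0) -> z = 0)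
          (gram_free A B F).
Proof.
apply: (iffP idP) => [free z zA zB | inj].
  pose y : 'rV[K]_#|A| := \row_k z 0 (enum_val k).
  have y0 : y = 0.
    apply: (row_free_inj free); rewrite mul0mx; apply/rowP => l.
    have := zB _ (enum_valP l); rewrite [in X in X = 0 -> _]mxE.
    rewrite (sum_supported (fun i => (F *m F^T) i (enum_val l)) zA) => zBl.
    by rewrite [LHS]mxE [RHS]mxE -[RHS]zBl; apply: eq_bigr => k _; rewrite !mxE.
  apply/rowP => i; rewrite mxE; have [iA|/zA //] := boolP (i \in A).
  by have /rowP/(_ (enum_rank_in iA i)) := y0; rewrite !mxE enum_rankK_in.
apply: inj_row_free => v vM.
pose z : 'rV[K]_n := v *m rowsub enum_val 1%:M.
have zE k : z 0 (enum_val k) = v 0 k.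
  rewrite mxE (bigD1 k) //= big1 ?addr0; first by rewrite !mxE eqxx mulr1.
  by move=> l lk; rewrite !mxE (inj_eq enum_val_inj) (negPf lk) mulr0.
have zA : supported_on A z.
  move=> i iA; rewrite mxE big1 // => k _; rewrite !mxE.
  case: eqP => [ki|_]; last by rewrite mulr0.
  by rewrite -ki enum_valP in iA.
have z0 : z = 0.
  apply: inj => // j jB; rewrite mxE (sum_supported (fun i => (F *m F^T) i j) zA).
  have /rowP/(_ (enum_rank_in jB j)) vMj := vM.
  rewrite mxE [X in _ = X]mxE in vMj; rewrite -[RHS]vMj.
  by apply: eq_bigr => k _; rewrite zE [in RHS]mxE enum_rankK_in.
by apply/rowP => k; rewrite -zE z0 !mxE.
Qed.

Lemma gram_free_inj d A B (F : 'M[K]_(n, d)) z : gram_free A B F ->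
  supported_on A z -> (forall j, j \in B -> (z *m (F *m F^T)) 0 j = 0) -> z = 0.
Proof. by move/gram_freeP; apply. Qed.

(** The matrix is square here, so full row rank passes to its transpose. *)
Lemma gram_free_sym d A B (F : 'M[K]_(n, d)) :
  #|A| = #|B| -> gram_free A B F -> gram_free B A F.
Proof.
move=> AB; rewrite /gram_free /row_free => /eqP rk.
by rewrite -mxrank_tr trmx_mxsub trmx_mul trmxK rk AB.
Qed.

Lemma gram_free_subr d A B C (F : 'M[K]_(n, d)) :
  B \subset C -> gram_free A B F -> gram_free A C F.
Proof.
move=> /subsetP BC /gram_freeP free; apply/gram_freeP => z zA zC.
by apply: free => // j /BC; apply: zC.
Qed.

Lemma gram_free_indep d A B (F : 'M[K]_(n, d)) z :
  gram_free A B F -> supported_on A z -> z *m F = 0 -> z = 0.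
Proof.
move=> /gram_freeP free zA zF; apply: free => // j _.
by rewrite mulmxA zF mul0mx mxE.
Qed.

Lemma gram_free_eq_gram d d' A B (F : 'M[K]_(n, d)) (F' : 'M[K]_(n, d')) :
  {in A & B, F *m F^T =2 F' *m F'^T} -> gram_free A B F = gram_free A B F'.
Proof.
move=> FF'; congr row_free; apply/matrixP => i j; rewrite mxE [RHS]mxE.
by apply: FF'; apply: enum_valP.
Qed.

(** There are fewer equations than unknowns. *)
Lemma not_gram_free d A B (F : 'M[K]_(n, d)) : (#|B| < #|A|)%N ->
  exists z, [/\ z != 0, supported_on A z
              & forall j, j \in B -> (z *m (F *m F^T)) 0 j = 0].
Proof.
move=> BA; apply: boolp.contrapT => none.
have : gram_free A B F.
  apply/gram_freeP => z zA zB; apply: boolp.contrapT => /eqP z0.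
  by apply: none; exists z.
rewrite /gram_free /row_free => /eqP rk.
have := rank_leq_col (mxsub (enum_val : 'I_#|A| -> 'I_n)
                            (enum_val : 'I_#|B| -> 'I_n) (F *m F^T)).
by rewrite rk leqNgt BA.
Qed.

End GramFree.

(** * Generic conditions along polynomial curves *)

Lemma poly_nonroot (K : numFieldType) (p : {poly K}) :
  p != 0 -> exists t, p.[t] != 0.
Proof.
move=> p0; apply: boolp.contrapT => none.
(* In characteristic zero the first [size p] natural numbers are distinct, and they outnumber the
   roots of [p]. *)
have : (size [seq i%:R : K | i <- iota 0 (size p)] < size p)%N.
  apply: max_poly_roots => //; last first.
    by rewrite map_inj_uniq ?iota_uniq //; apply: mulrIn; rewrite oner_eq0.
  apply/allP => x _; apply: boolp.contrapT => rx; apply: none; exists x.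
  exact/negP.
by rewrite size_map size_iota ltnn.
Qed.

Section CurveOpen.
Variables (K : numFieldType) (n d : nat).
Implicit Types (F : 'M[K]_(n, d)) (Phi : 'M[{poly K}]_(n, d)).

Local Notation "Phi @[ t ]" := (map_mx (horner_eval t) Phi)
  (at level 2, format "Phi @[ t ]").

(* A Zariski open set is [curve_open]; restricting to curves spares
   multivariate polynomials. *)
Definition curve_open (O : 'M[K]_(n, d) -> Prop) :=
  forall Phi t0, O Phi@[t0] ->
    exists2 p : {poly K}, p != 0 & forall t, p.[t] != 0 -> O Phi@[t].

Lemma curve_openI O1 O2 : curve_open O1 -> curve_open O2 ->
  curve_open (fun F => O1 F /\ O2 F).
Proof.
move=> o1 o2 Phi t0 [/o1[p p0 pO] /o2[q q0 qO]]; exists (p * q).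
  by rewrite mulf_neq0.
by move=> t; rewrite hornerM mulf_eq0 => /norP[/pO ? /qO].
Qed.

Lemma curve_open_all (T : eqType) (s : seq T) (O : T -> 'M[K]_(n, d) -> Prop) :
  (forall x, curve_open (O x)) ->
  curve_open (fun F => forall x, x \in s -> O x F).
Proof.
move=> oO; elim: s => [|x s IH] Phi t0.
  by exists 1; [exact: oner_neq0 | move=> t _ x; rewrite in_nil].
move=> H; have [|p p0 pO] := curve_openI (oO x) IH (Phi := Phi) (t0 := t0).
  by split=> [|y ys]; apply: H; rewrite inE ?eqxx ?ys ?orbT.
exists p => // t /pO[Ox Os] y; rewrite inE => /predU1P[->//|]; exact: Os.
Qed.

Lemma gram_map Phi t :
  Phi@[t] *m Phi@[t]^T = map_mx (horner_eval t) (Phi *m Phi^T).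
Proof. by rewrite map_mxM map_trmx. Qed.

(** A right inverse [Y] at [t0] replaces the choice of a maximal minor: the determinant of the Gram
    matrix times the constant [Y] is a polynomial with value 1 at [t0], and the rank is full
    wherever it is nonzero. *)
Lemma curve_open_gram_free A B : curve_open (@gram_free K n d A B).
Proof.
move=> Phi t0; rewrite /gram_free gram_map => /row_freeP[Y MY].
pose M := mxsub (enum_val : 'I_#|A| -> 'I_n) (enum_val : 'I_#|B| -> 'I_n)
                (Phi *m Phi^T).
have evalM t : (\det (M *m map_mx polyC Y)).[t] =
    \det (mxsub enum_val enum_val (map_mx (horner_eval t) (Phi *m Phi^T)) *m Y).
  rewrite -[LHS]/(horner_eval t _) -det_map_mx map_mxM map_mxsub -map_mx_comp.
  congr (\det (_ *m _)); apply/matrixP => i j.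
  by rewrite mxE /= /horner_eval hornerC.
exists (\det (M *m map_mx polyC Y)).
  apply: contra_neq (oner_neq0 K) => d0.
  by rewrite -(det1 K #|A|) -MY -evalM d0 horner0.
move=> t; rewrite evalM -unitfE -unitmxE gram_map => U.
by rewrite -row_leq_rank -{1}(mxrank_unit U) mxrankM_maxl.
Qed.

Lemma curve_open_gram_neq0 i j : curve_open (fun F => (F *m F^T) i j != 0).
Proof.
move=> Phi t0; rewrite gram_map mxE => nz; exists ((Phi *m Phi^T) i j).
  by apply: contra_neq nz => ->; rewrite /horner_eval horner0.
by move=> t nz_t; rewrite gram_map mxE.
Qed.

End CurveOpen.

(** * Replacing one row *)

Section SetRow.
Variables (R : comNzRingType) (n d : nat).
Implicit Types (F : 'M[R]_(n, d)) (v : 'rV[R]_d).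

Definition set_row (w : 'I_n) v F : 'M[R]_(n, d) :=
  \matrix_i (if i == w then v else row i F).

Lemma row_set_row w v F i :
  row i (set_row w v F) = if i == w then v else row i F.
Proof. by rewrite rowK. Qed.

Lemma gram_row F i j : (F *m F^T) i j = (row i F *m (row j F)^T) 0 0.
Proof. by rewrite !mxE; apply: eq_bigr => k _; rewrite !mxE. Qed.

Lemma gram_sym F i j : (F *m F^T) i j = (F *m F^T) j i.
Proof. by rewrite !mxE; apply: eq_bigr => k _; rewrite !mxE mulrC. Qed.

Lemma gram_set_row w v F i j : i != w -> j != w ->
  (set_row w v F *m (set_row w v F)^T) i j = (F *m F^T) i j.
Proof.
by move=> iw jw; rewrite !gram_row !row_set_row (negPf iw) (negPf jw).
Qed.

Lemma gram_set_row_w w v F i : i != w ->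
  (set_row w v F *m (set_row w v F)^T) i w = (v *m (row i F)^T) 0 0.
Proof.
move=> iw; rewrite gram_sym gram_row !row_set_row eqxx (negPf iw) //.
Qed.

End SetRow.

(** * Orthogonal projection without division *)

Section Projector.
Variables (R : comNzRingType) (n d : nat) (A : {set 'I_n}).
Implicit Types (F : 'M[R]_(n, d)).

Definition mask_rows F : 'M[R]_(n, d) := \matrix_(i, k) (F i k *+ (i \in A)).
Definition off : 'M[R]_n := diag_mx (\row_i (i \notin A)%:R).
Definition masked_gram F : 'M[R]_n := mask_rows F *m (mask_rows F)^T + off.

(* A division-free multiple of the orthogonal projector onto the orthogonal
   complement of the rows of [F] with index in [A]; adding [off] avoids
   reindexing, as it pads the Gram matrix of these rows with an identity
   block. *)
Definition coprojector F : 'M[R]_d :=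
  (\det (masked_gram F))%:M -
  (mask_rows F)^T *m \adj (masked_gram F) *m mask_rows F.

Lemma mask_rows_off F : (mask_rows F)^T *m off = 0.
Proof.
apply/matrixP => k i; rewrite mxE [RHS]mxE big1 // => j _; rewrite !mxE.
case: eqVneq => _; last by rewrite mulr0n mulr0.
by case: (j \in A); rewrite /= ?mulr0n ?mul0rn ?mulr0 ?mul0r.
Qed.

Lemma masked_gram_off F : masked_gram F *m off = off.
Proof.
rewrite mulmxDl -mulmxA mask_rows_off mulmx0 add0r; apply/matrixP => i j.
rewrite mul_diag_mx !mxE.
case: eqVneq => _; last by rewrite !mulr0n mulr0.
by case: (i \in A); rewrite /= ?mulr0n ?mul0rn ?mulr0 ?mulr1n ?mulr1.
Qed.

(** The product of [mask_rows] with its transpose is the masked Gram matrix minus [off]. The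
    adjugate turns the former into the determinant, and the contribution of [off] dies against the
    transposed rows. *)
Lemma coprojector_orth F : coprojector F *m (mask_rows F)^T = 0.
Proof.
have adj_off : \adj (masked_gram F) *m off = (\det (masked_gram F))%:M *m off.
  by rewrite -[in LHS](masked_gram_off F) mulmxA mul_adj_mx.
rewrite mulmxBl -!mulmxA.
have -> : mask_rows F *m (mask_rows F)^T = masked_gram F - off by rewrite addrK.
rewrite mulmxBr mul_adj_mx adj_off mulmxBr mulmxA mul_mx_scalar -scalemxAl.
by rewrite mask_rows_off scaler0 subr0 mul_scalar_mx subrr.
Qed.

Lemma coprojector_fix F (v : 'rV[R]_d) : v *m (mask_rows F)^T = 0 ->
  v *m coprojector F = \det (masked_gram F) *: v.
Proof.
by move=> v0; rewrite mulmxBr !mulmxA v0 !mul0mx subr0 mul_mx_scalar.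
Qed.

End Projector.

(** Applied to evaluation: the projector along a curve specializes to the projector at each
    point. *)
Lemma map_coprojector (R S : comNzRingType) (f : {rmorphism R -> S}) n d
    (A : {set 'I_n}) (F : 'M[R]_(n, d)) :
  map_mx f (coprojector A F) = coprojector A (map_mx f F).
Proof.
have mE : map_mx f (mask_rows A F) = mask_rows A (map_mx f F).
  by apply/matrixP => i j; rewrite !mxE rmorphMn.
have oE : map_mx f (off R A) = off S A.
  rewrite /off map_diag_mx; congr diag_mx; apply/rowP => i.
  by rewrite !mxE rmorph_nat.
have gE : map_mx f (masked_gram A F) = masked_gram A (map_mx f F).
  by rewrite map_mxD map_mxM -map_trmx mE oE.
by rewrite map_mxB map_scalar_mx -det_map_mx !map_mxM -map_trmx map_mx_adj gE mE.
Qed.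

(** In a kernel vector, the identity block kills the coordinates outside [A]; what remains is in the
    kernel of the Gram matrix of [A]. *)
Lemma det_masked_gram_neq0 (K : fieldType) n d (A : {set 'I_n})
    (F : 'M[K]_(n, d)) :
  gram_free A A F -> \det (masked_gram A F) != 0.
Proof.
move=> free; apply/negP => /det0P[z z0 zG].
have zM i : (z *m (mask_rows A F *m (mask_rows A F)^T)) 0 i +
            z 0 i * (i \notin A)%:R = 0.
  have <- : (z *m masked_gram A F) 0 i = 0 by rewrite zG mxE.
  by rewrite mulmxDr mul_mx_diag [RHS]mxE; congr (_ + _); rewrite !mxE.
have zA : supported_on A z.
  move=> i iA; have := zM i; rewrite iA mulr1 mulmxA mxE big1 ?add0r // => k _.
  by rewrite !mxE (negPf iA) mulr0.
have zF : z *m mask_rows A F = z *m F.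
  apply/rowP => k; rewrite !mxE; apply: eq_bigr => i _; rewrite !mxE.
  by case: (boolP (i \in A)) => // /zA ->; rewrite !mul0r.
case/eqP: z0; apply: gram_free_inj free zA _ => j jA.
have := zM j; rewrite jA mulr0 addr0 !mulmxA zF => <-.
by rewrite !mxE; apply: eq_bigr => k _; rewrite !mxE jA.
Qed.

(** * Joining orthogonal representations by curves *)

Section RegularRep.
Variables (K : numFieldType) (n : nat) (N : 'I_n -> {set 'I_n}).
Hypothesis N_lt : forall i j, i \in N j -> (i < j)%N.

(** Any commutative ring is allowed so that curves, with polynomial entries, are covered as well. *)
Definition orth_rep (R : comNzRingType) d m (F : 'M[R]_(n, d)) :=
  forall j : 'I_n, (j < m)%N -> forall i, i \in N j -> (F *m F^T) i j = 0.

(* The condition on the Gram matrices makes the representations smooth points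
   of the variety of orthogonal representations: this is what allows joining
   them by a curve in [regular_rep_path]. *)
Definition regular_rep d m (F : 'M[K]_(n, d)) :=
  orth_rep m F /\ forall j : 'I_n, (j < m)%N -> gram_free (N j) (N j) F.

Lemma regular_repW d m (F : 'M[K]_(n, d)) :
  regular_rep m.+1 F -> regular_rep m F.
Proof. by case=> o f; split=> j jm; [apply: o | apply: f]; apply: ltnW. Qed.

Lemma orth_rep_set_row (R : comNzRingType) d (w : 'I_n) (v : 'rV[R]_d)
    (F : 'M[R]_(n, d)) :
  orth_rep w F -> (forall i, i \in N w -> (v *m (row i F)^T) 0 0 = 0) ->
  orth_rep w.+1 (set_row w v F).
Proof.
move=> oF vN j; rewrite ltnS leq_eqVlt => /predU1P[/val_inj -> | jw] i iN.
  rewrite gram_set_row_w ?vN //; apply: contraTneq (N_lt iN) => ->.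
  by rewrite ltnn.
have neqw (k : 'I_n) : (k < w)%N -> k != w.
  by apply: contraTneq => ->; rewrite ltnn.
by rewrite gram_set_row ?oF ?neqw //; apply: ltn_trans jw; apply: N_lt.
Qed.

Lemma gram_free_set_row d (w : 'I_n) v (A B : {set 'I_n}) (F : 'M[K]_(n, d)) :
  w \notin A -> w \notin B ->
  gram_free A B (set_row w v F) = gram_free A B F.
Proof.
move=> wA wB; apply: gram_free_eq_gram => i j iA jB; apply: gram_set_row.
  by apply: contraNneq wA => <-.
by apply: contraNneq wB => <-.
Qed.

Lemma notin_N (j w : 'I_n) : (j <= w)%N -> w \notin N j.
Proof. by move=> jw; apply/negP => /N_lt; rewrite ltnNge jw. Qed.

Lemma regular_rep_set_row d (w : 'I_n) (v : 'rV[K]_d) (F : 'M[K]_(n, d)) :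
  regular_rep w F -> gram_free (N w) (N w) F ->
  (forall i, i \in N w -> (v *m (row i F)^T) 0 0 = 0) ->
  regular_rep w.+1 (set_row w v F).
Proof.
move=> [oF fF] fw vN; split; first exact: orth_rep_set_row.
move=> j jw; rewrite gram_free_set_row ?notin_N //.
by move: jw; rewrite ltnS leq_eqVlt => /predU1P[/val_inj -> //|/fF].
Qed.

Lemma regular_repS_le d m (F : 'M[K]_(n, d)) :
  (n <= m)%N -> regular_rep m F -> regular_rep m.+1 F.
Proof.
by move=> nm [o f]; split=> j _; [apply: o | apply: f]; apply: leq_trans nm.
Qed.

(** Induction on [m], starting from a segment: row [w] of the curve becomes the segment between the
    two given rows, projected orthogonally to the rows of [N w]. Regularity at both ends makes the
    determinants there nonzero, so that rescaling restores the endpoints. In between, the curve need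
    not be regular. *)
Lemma regular_rep_path d m (F0 F1 : 'M[K]_(n, d)) :
  regular_rep m F0 -> regular_rep m F1 ->
  exists Phi : 'M[{poly K}]_(n, d),
    [/\ orth_rep m Phi, map_mx (horner_eval 0) Phi = F0
      & map_mx (horner_eval 1) Phi = F1].
Proof.
elim: m => [|m IH] r0 r1.
  exists (map_mx polyC F0 + 'X *: map_mx polyC (F1 - F0)); split=> //.
    by apply/matrixP => i j; rewrite !mxE /horner_eval !hornerE.
  by apply/matrixP => i j; rewrite !mxE /horner_eval !hornerE /=; ring.
have [Phi [oPhi Phi0 Phi1]] := IH (regular_repW r0) (regular_repW r1).
have [nm|mn] := leqP n m.
  by exists Phi; split=> // j _; apply: oPhi; apply: leq_trans nm.
pose w : 'I_n := Ordinal mn.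
have [[o0 f0] [o1 f1]] := (r0, r1).
pose delta F := \det (masked_gram (N w) F).
have d0 : delta K _ F0 != 0 by apply/det_masked_gram_neq0/f0.
have d1 : delta K _ F1 != 0 by apply/det_masked_gram_neq0/f1.
(* [c] interpolates the inverse determinants, to cancel at 0 and 1 the factor introduced by the
   division-free projector. *)
pose c : {poly K} := (1 - 'X) * (delta K _ F0)^-1%:P + 'X * (delta K _ F1)^-1%:P.
pose l : 'rV[{poly K}]_d := map_mx polyC (row w F0)
  + 'X *: map_mx polyC (row w F1 - row w F0).
pose v := c *: (l *m coprojector (N w) Phi).
have vN i : i \in N w -> (v *m (row i Phi)^T) 0 0 = 0.
  move=> iN.
  have -> : (row i Phi)^T = (mask_rows (N w) Phi)^T *m delta_mx i (0 : 'I_1).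
    rewrite -colE -tr_row; congr (_^T); apply/rowP => k.
    by rewrite !mxE iN.
  by rewrite mulmxA -scalemxAl -mulmxA coprojector_orth mulmx0 scaler0 mul0mx mxE.
have eval_v t F : map_mx (horner_eval t) Phi = F -> orth_rep m.+1 F ->
    c.[t] * delta K _ F = 1 -> map_mx (horner_eval t) l = row w F ->
    map_mx (horner_eval t) v = row w F.
  move=> PF oF cd lF; rewrite map_mxZ map_mxM map_coprojector PF lF.
  rewrite coprojector_fix ?scalerA; first by rewrite [_ * _]cd scale1r.
  apply/rowP => i; rewrite mxE [RHS]mxE.
  have [iN|iN] := boolP (i \in N w); last first.
    by rewrite big1 // => k _; rewrite !mxE (negPf iN) mulr0.
  rewrite -[RHS](oF w (ltnSn m) i iN) gram_sym [RHS]mxE; apply: eq_bigr => k _.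
  by rewrite !mxE iN.
exists (set_row w v Phi); split.
- exact: (orth_rep_set_row (w := w) oPhi vN).
- rewrite -Phi0; apply/row_matrixP => i; rewrite -map_row row_set_row -map_row.
  case: eqVneq => [->|//]; rewrite map_row Phi0; apply: eval_v => //.
    by rewrite /c !hornerE ?subr0 ?subrr ?mul0r ?add0r ?mul1r mulVf.
  by apply/rowP => k; rewrite !mxE /horner_eval !hornerE.
- rewrite -Phi1; apply/row_matrixP => i; rewrite -map_row row_set_row -map_row.
  case: eqVneq => [->|//]; rewrite map_row Phi1; apply: eval_v => //.
    by rewrite /c !hornerE ?subr0 ?subrr ?mul0r ?add0r ?mul1r mulVf.
  by apply/rowP => k; rewrite !mxE /horner_eval !hornerE /=; ring.
Qed.

Lemma curve_open_regular d m :
  curve_open (fun F : 'M[K]_(n, d) =>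
    forall j, j \in [seq j : 'I_n <- enum 'I_n | (j < m)%N] ->
      gram_free (N j) (N j) F).
Proof. by apply: curve_open_all => j; apply: curve_open_gram_free. Qed.

(** A substitute for irreducibility: on a curve joining the two witnesses, orthogonality holds
    everywhere, while regularity, [O0] and [O1] each hold off the roots of a nonzero polynomial. *)
Lemma regular_rep_meet d m (O0 O1 : 'M[K]_(n, d) -> Prop) :
  curve_open O0 -> curve_open O1 ->
  (exists2 F, regular_rep m F & O0 F) -> (exists2 F, regular_rep m F & O1 F) ->
  exists2 F, regular_rep m F & O0 F /\ O1 F.
Proof.
move=> o0 o1 [F0 r0 OF0] [F1 r1 OF1].
have [Phi [oPhi Phi0 Phi1]] := regular_rep_path r0 r1.
have [|p p0 pO] := curve_openI (@curve_open_regular d m) o0 (Phi := Phi) (t0 := 0).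
  by rewrite Phi0; split=> // j; rewrite mem_filter => /andP[/(r0.2 _)].
have [|q q0 qO] := o1 Phi 1; first by rewrite Phi1.
have [t] : exists t, (p * q).[t] != 0 by apply: poly_nonroot; rewrite mulf_neq0.
rewrite hornerM mulf_eq0 => /norP[/pO[free OF] /qO O1F].
exists (map_mx (horner_eval t) Phi); split=> //.
  move=> j jm i iN; rewrite gram_map mxE oPhi // /horner_eval horner0 //.
by move=> j jm; apply: free; rewrite mem_filter jm mem_enum.
Qed.

End RegularRep.

(** * Enlarging the index sets by one vertex *)

Section GramStep.
Variables (K : fieldType) (n d : nat).
Implicit Types (A B : {set 'I_n}) (F : 'M[K]_(n, d)).

Lemma mul_gram (z : 'rV[K]_n) F j :
  (z *m (F *m F^T)) 0 j = (z *m F *m (row j F)^T) 0 0.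
Proof. by rewrite mulmxA !mxE; apply: eq_bigr => k _; rewrite !mxE. Qed.

Lemma dot_supported B F (u : 'rV[K]_d) (y : 'rV[K]_n) : supported_on B y ->
  (forall j, j \in B -> (u *m (row j F)^T) 0 0 = 0) ->
  (u *m (y *m F)^T) 0 0 = 0.
Proof.
move=> yB uB; rewrite trmx_mul mulmxA mxE big1 // => j _.
have [jB|/yB y0] := boolP (j \in B); last by rewrite [y^T _ _]mxE y0 mulr0.
rewrite (_ : (u *m F^T) 0 j = 0) ?mul0r // -[RHS](uB j jB) !mxE.
by apply: eq_bigr => k _; rewrite !mxE.
Qed.

Lemma mul_set_row (z : 'rV[K]_n) w v F :
  z *m set_row w v F = z 0 w *: v + (z - z 0 w *: delta_mx 0 w) *m F.
Proof.
apply/rowP => k; rewrite !mxE (bigD1 w) //= [X in _ = _ + X](bigD1 w) //=.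
rewrite !mxE !eqxx mulr1 subrr mul0r add0r; congr (_ + _).
by apply: eq_bigr => i /negPf iw; rewrite !mxE iw andbF mulr0 subr0 !mxE.
Qed.

(** Some column of the cokernel of the rows of [A] detects that [a] is outside their span. *)
Lemma exists_orth A F (a : 'rV[K]_d) :
  (forall z, supported_on A z -> z *m F <> a) ->
  exists v : 'rV[K]_d, (v *m a^T) 0 0 != 0 /\
    forall i, i \in A -> (v *m (row i F)^T) 0 0 = 0.
Proof.
move=> aF; pose M := mask_rows A F.
have : ~~ (a <= M)%MS.
  apply/negP => /submxP[c ac].
  pose z : 'rV[K]_n := \row_i (c 0 i *+ (i \in A)).
  apply: (aF z) => [i iA|]; first by rewrite mxE (negPf iA).
  rewrite ac; apply/rowP => k; rewrite !mxE; apply: eq_bigr => i _.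
  by rewrite !mxE; case: (i \in A); rewrite ?mulr0n ?mul0r ?mulr0 ?mulr1n.
rewrite submxE => /eqP/rowP/boolp.existsNP[k /eqP]; rewrite [X in _ != X]mxE => nz.
exists (col k (cokermx M))^T; split.
  apply: contra_neq nz => va0; rewrite -[RHS]va0 !mxE.
  by apply: eq_bigr => i _; rewrite !mxE mulrC.
move=> i iA; have /matrixP/(_ i k) := mulmx_coker M; rewrite [X in _ = X]mxE => <-.
by rewrite !mxE; apply: eq_bigr => l _; rewrite !mxE iA mulrC.
Qed.

(** The vector [y *m F] is in the span of [B] and orthogonal to [A]. Pairing it with a combination
    orthogonal to [B] isolates the coefficient of [w], which is therefore zero. *)
Lemma gram_free_add_left w v A B F : w \notin A -> w \notin B ->
  gram_free A B F ->
  (exists y, [/\ supported_on B y, (v *m (y *m F)^T) 0 0 != 0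
    & forall i, i \in A -> (y *m (F *m F^T)) 0 i = 0]) ->
  gram_free (w |: A) B (set_row w v F).
Proof.
move=> wA wB free [y [yB va yA]]; apply/gram_freeP => z zA zB.
pose z0 := z - z 0 w *: delta_mx 0 w.
have z0A : supported_on A z0.
  move=> i iA; rewrite !mxE eqxx /=; case: eqVneq => [->|iw].
    by rewrite mulr1 subrr.
  by rewrite mulr0 subr0 zA // !inE negb_or iw.
have zB' j : j \in B -> ((z 0 w *: v + z0 *m F) *m (row j F)^T) 0 0 = 0.
  move=> jB; rewrite -(zB j jB) mul_gram mul_set_row row_set_row.
  by case: eqVneq jB => // ->; rewrite (negPf wB).
have zw : z 0 w = 0.
  have := dot_supported yB zB'; rewrite mulmxDl [X in X = _ -> _]mxE.
  have -> : (z0 *m F *m (y *m F)^T) 0 0 = 0.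
    have -> : z0 *m F *m (y *m F)^T = (y *m F *m (z0 *m F)^T)^T.
      by rewrite [RHS]trmx_mul trmxK.
    rewrite mxE; apply: (dot_supported z0A) => i iA.
    by rewrite -mul_gram yA.
  rewrite addr0 -scalemxAl mxE => /eqP; rewrite mulf_eq0 (negPf va) orbF.
  by move/eqP.
have zz0 : z = z0 by rewrite /z0 zw scale0r subr0.
rewrite zz0; apply: gram_free_inj free z0A _ => j jB.
by rewrite -(zB' j jB) zw scale0r add0r mul_gram.
Qed.

(** A new first coordinate is reserved for [w], whose vector becomes orthogonal to all others
    without changing their products. *)
Definition add_unit_row w F : 'M[K]_(n, 1 + d) :=
  row_mx (delta_mx w 0) (set_row w 0 F).

Lemma gram_add_unit_row w F i j :
  (add_unit_row w F *m (add_unit_row w F)^T) i j =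
  if (i == w) || (j == w) then ((i == w) && (j == w))%:R
  else (F *m F^T) i j.
Proof.
rewrite tr_row_mx mul_row_col trmx_delta mul_delta_mx mxE mxE.
have [-> | iw] := eqVneq i w; have [-> | jw] := eqVneq j w => /=.
- by rewrite gram_row row_set_row eqxx mul0mx mxE addr0.
- by rewrite gram_row row_set_row eqxx mul0mx mxE addr0.
- by rewrite gram_set_row_w // mul0mx mxE addr0.
by rewrite gram_set_row // add0r.
Qed.

Lemma gram_free_add_unit_row w A B F : w \notin A -> w \notin B ->
  gram_free A B (add_unit_row w F) = gram_free A B F.
Proof.
move=> wA wB; apply: gram_free_eq_gram => i j iA jB.
rewrite gram_add_unit_row ifF //; apply/negP => /orP[] /eqP E.
  by rewrite -E iA in wA.
by rewrite -E jB in wB.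
Qed.

Lemma gram_free_add_unit w A B F : w \notin A -> w \notin B ->
  gram_free A B F -> gram_free (w |: A) (w |: B) (add_unit_row w F).
Proof.
move=> wA wB; rewrite -(gram_free_add_unit_row F wA wB) => free.
apply/gram_freeP => z zA zB.
have zw : z 0 w = 0.
  rewrite -[RHS](zB w (setU11 _ _)) mxE (bigD1 w) //= big1 => [|i iw].
    by rewrite gram_add_unit_row eqxx mulr1 addr0.
  by rewrite gram_add_unit_row eqxx orbT (negPf iw) mulr0.
apply: (gram_free_inj (gram_free_subr (subsetUr [set w] B) free)) => // i iA.
by have [->//|iw] := eqVneq i w; apply: zA; rewrite !inE negb_or iw.
Qed.

End GramStep.

(** * Full rank for dominating sets *)

Section Dominating.
Variables (n : nat) (N : 'I_n -> {set 'I_n}).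

Definition before (m : nat) : {set 'I_n} := [set i : 'I_n | (i < m)%N].

(** Removing the last vertex [w] from [A], if present, leaves a dominating set with at least
    [#|N w|] elements, so an induction can compare [N w] with it. *)
Definition dominating m (A : {set 'I_n}) :=
  A \subset before m /\
  forall i : 'I_n, (i < m)%N -> (#|N i| <= #|A :&: before i|)%N.

Lemma beforeS (w : 'I_n) : before w.+1 = w |: before w.
Proof. by apply/setP => i; rewrite !inE ltnS leq_eqVlt. Qed.

Lemma dominatingD1 (w : 'I_n) A : dominating w.+1 A ->
  dominating w (A :\ w) /\ (#|N w| <= #|A :\ w|)%N.
Proof.
move=> [Aw domA]; have Aw' : A :\ w \subset before w.
  apply/subsetP => i; rewrite !inE => /andP[iw /(subsetP Aw)].
  by rewrite beforeS !inE (negPf iw).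
have cap (j : 'I_n) : (j <= w)%N -> A :&: before j = (A :\ w) :&: before j.
  move=> jw; apply/setP => i; rewrite !inE; case: eqVneq => [->|//].
  by rewrite ltnNge jw andbF.
split; first split=> // i iw.
  by rewrite -(cap i (ltnW iw)); apply/domA/ltnW.
by have := domA w (ltnSn w); rewrite cap // (setIidPl Aw').
Qed.

Hypothesis N_dom : forall j : 'I_n, dominating j (N j).

Lemma N_lt i j : i \in N j -> (i < j)%N.
Proof. by move=> iN; have := subsetP (N_dom j).1 _ iN; rewrite inE. Qed.

Variable K : numFieldType.

(* Induction on the last vertex w.  If w is in both sets, take f_w = e_d and the
   other vectors in dimension d - 1.  If w is only in A, then A \ w is smaller
   than B, hence some nonzero vector a of the span of B is orthogonal to A \ w,
   and f_w must not be orthogonal to a; this is possible because a is not in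
   the span of N w, whose Gram matrix with A \ w has full row rank as
   |N w| <= |A \ w|. *)
Lemma free_rep m d A B :
  dominating m A -> dominating m B -> (#|A| <= #|B|)%N -> (#|B| <= d)%N ->
  exists2 F : 'M[K]_(n, d), regular_rep N m F & gram_free A B F.
Proof.
elim: m d A B => [|m IH] d A B domA domB AB Bd.
  exists 0 => //; apply/gram_freeP => z zA _; apply/rowP => i; rewrite mxE zA //.
  by apply/negP => /(subsetP domA.1); rewrite inE.
have [nm|mn] := leqP n m.
  have domW C : dominating m.+1 C -> dominating m C.
    move=> [_ domC]; split=> [|i im]; last by apply: domC; apply: ltnW.
    by apply/subsetP => i _; rewrite inE (leq_trans _ nm).
  have [F rF fF] := IH d A B (domW _ domA) (domW _ domB) AB Bd.
  by exists F => //; apply: regular_repS_le.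
pose w : 'I_n := Ordinal mn.
have N_w := N_dom w : dominating m (N w).
have meet O0 O1 := @regular_rep_meet K n N N_lt d m O0 O1.
have open C D := @curve_open_gram_free K n d C D.
(* Also used with the two sets exchanged, when [w] lies only in [B]. *)
have step_left A' B' : dominating m.+1 A' -> dominating m.+1 B' ->
    w \in A' -> w \notin B' -> (#|A'| <= #|B'|)%N -> (#|B'| <= d)%N ->
    exists2 F : 'M[K]_(n, d), regular_rep N m.+1 F & gram_free A' B' F.
  move=> /(dominatingD1 (w := w))[domA' NA'] /(dominatingD1 (w := w))[domB' _].
  move=> wA' wB'; rewrite (cardsD1 w A') wA' add1n => A'B' B'd.
  have B'E : B' :\ w = B'.
    by apply/setP => i; rewrite !inE; case: eqVneq => // ->; rewrite (negPf wB').
  rewrite {}B'E in domB'.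
  have A0d := leq_trans (ltnW A'B') B'd.
  have Nd := leq_trans NA' A0d.
  (* Besides the rank to be extended: [fBB] makes the rows of [B'] independent, [fNA] compares [N w]
     with [A'] without [w], and [fNN] is regularity at [w]. *)
  have [F rF [[fAB fBB] [fNA fNN]]] := meet _ _
    (curve_openI (open _ _) (open _ _)) (curve_openI (open _ _) (open _ _))
    (meet _ _ (open _ _) (open _ _) (IH d _ _ domA' domB' (ltnW A'B') B'd)
       (IH d _ _ domB' domB' (leqnn _) B'd))
    (meet _ _ (open _ _) (open _ _) (IH d _ _ N_w domA' NA' A0d)
       (IH d _ _ N_w N_w (leqnn _) Nd)).
  have [y [y0 yB yA]] := not_gram_free F A'B'.
  (* A combination of [N w] equal to [y *m F] would be orthogonal to [A'] without [w], hence zero,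
     against the independence of [B']. *)
  have [z zN zFy|v [vy vN]] := @exists_orth K n d (N w) F (y *m F).
    have z0 : z = 0.
      apply: gram_free_inj fNA zN _ => j /yA.
      by rewrite !mulmxA zFy.
    case/eqP: y0; apply: gram_free_indep fBB yB _.
    by rewrite -zFy z0 mul0mx.
  exists (set_row w v F); first exact: (regular_rep_set_row N_lt (w := w)).
  rewrite -(setD1K wA'); apply: gram_free_add_left => //.
    by rewrite !inE eqxx.
  by exists y.
have [domA0 NA] := dominatingD1 (w := w) domA.
have [domB0 NB] := dominatingD1 (w := w) domB.
have [wA|wA] := boolP (w \in A); have [wB|wB] := boolP (w \in B).
- move: AB Bd; rewrite (cardsD1 w A) (cardsD1 w B) wA wB !add1n ltnS.
  (* [d] is positive because [w] is in [B]; the induction hypothesis is used one dimension lower. *)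
  case: d {meet open step_left} => // d AB Bd.
  have open C D := @curve_open_gram_free K n d C D.
  have [F rF [fAB fNN]] := @regular_rep_meet K n N N_lt d m _ _ (open _ _) (open _ _)
    (IH d _ _ domA0 domB0 AB Bd)
    (IH d _ _ N_w N_w (leqnn _) (leq_trans NB Bd)).
  have neq0 C : w \notin C :\ w by rewrite !inE eqxx.
  have Nw_notin (j : 'I_n) : (j <= m)%N -> w \notin N j.
    by move=> jm; apply: (notin_N N_lt).
  exists (add_unit_row w F : 'M_(n, d.+1)).
    split=> [j jm i iN|j jm]; last first.
      rewrite gram_free_add_unit_row ?Nw_notin //.
      move: jm; rewrite ltnS leq_eqVlt => /predU1P[jm|/rF.2 //].
      by have -> : j = w by apply: val_inj.
    have iw : (i == w) = false.
      by apply/eqP => iw; move: (Nw_notin j jm); rewrite -iw iN.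
    rewrite gram_add_unit_row iw /=; case: eqVneq => // jw.
    apply: rF.1 iN; rewrite ltn_neqAle -ltnS jm andbT.
    by apply: contra_neq jw => jm_eq; apply: val_inj.
  by rewrite -(setD1K wA) -(setD1K wB); apply: gram_free_add_unit.
- exact: step_left.
(* If [B] without [w] is still large enough, the zero vector at [w] will do; otherwise the cardinals
   agree and the two sets can be exchanged. *)
- have [AB0|BA] := leqP #|A| #|B :\ w|.
    have A0 : A :\ w = A.
      by apply/setP => i; rewrite !inE; case: eqVneq => // ->; rewrite (negPf wA).
    have B0d := leq_trans (subset_leq_card (subsetDl B [set w])) Bd.
    rewrite A0 in domA0.
    have [F rF [fAB fNN]] := meet _ _ (open _ _) (open _ _)
      (IH d _ _ domA0 domB0 AB0 B0d) (IH d _ _ N_w N_w (leqnn _) (leq_trans NB B0d)).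
    exists (set_row w 0 F).
      apply: (regular_rep_set_row N_lt (w := w)) => // i _.
      by rewrite mul0mx mxE.
    apply: (gram_free_subr (subsetDl B [set w])).
    by rewrite gram_free_set_row // !inE eqxx.
  have AB' : #|A| = #|B|.
    by apply/eqP; rewrite eqn_leq AB (cardsD1 w B) wB add1n BA.
  have [||F rF fBA] := step_left B A domB domA wB wA; rewrite ?AB' //.
  by exists F => //; apply: gram_free_sym.
- have A0 : A :\ w = A.
    by apply/setP => i; rewrite !inE; case: eqVneq => // ->; rewrite (negPf wA).
  have B0 : B :\ w = B.
    by apply/setP => i; rewrite !inE; case: eqVneq => // ->; rewrite (negPf wB).
  rewrite A0 B0 in domA0 domB0 NB.
  have [F rF [fAB fNN]] := meet _ _ (open _ _) (open _ _)
    (IH d _ _ domA0 domB0 AB Bd) (IH d _ _ N_w N_w (leqnn _) (leq_trans NB Bd)).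
  exists (set_row w 0 F).
    by apply: (regular_rep_set_row N_lt (w := w)) => // i _; rewrite mul0mx mxE.
  by rewrite gram_free_set_row.
Qed.

End Dominating.

(** * From single edges to a faithful representation *)

Section FaithfulRep.
Variables (K : numFieldType) (n : nat) (N : 'I_n -> {set 'I_n}) (d : nat).
Hypothesis N_dom : forall j : 'I_n, dominating N j (N j).
Hypothesis N_card : forall j : 'I_n, (#|N j| < d)%N.

(** [free_rep] supplies the rank condition at each next vertex [w], which then receives the zero
    vector: this is orthogonal to everything and preserves [O]. *)
Lemma regular_rep_extend m k (O : 'M[K]_(n, d) -> Prop) : curve_open O ->
  (forall (w : 'I_n) F, (m <= w)%N -> O F -> O (set_row w 0 F)) ->
  (exists2 F, regular_rep N m F & O F) ->
  exists2 F, regular_rep N (m + k) F & O F.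
Proof.
move=> oO Oset; elim: k => [|k IH] ex; first by rewrite addn0.
have exF := IH ex; rewrite addnS.
have [nm|mn] := leqP n (m + k).
  by case: exF => F rF OF; exists F => //; apply: regular_repS_le.
pose w : 'I_n := Ordinal mn.
have [F rF [OF fF]] := regular_rep_meet (N_lt N_dom) oO
  (@curve_open_gram_free K n d (N w) (N w)) exF
  (free_rep N_dom K (N_dom w) (N_dom w) (leqnn _) (ltnW (N_card w))).
exists (set_row w 0 F); last by apply: Oset => //; apply: leq_addr.
by apply: (regular_rep_set_row (N_lt N_dom) (w := w)) => // i _; rewrite mul0mx mxE.
Qed.

Lemma edge_rep (p x : 'I_n) : (p < x)%N -> p \notin N x ->
  exists2 F : 'M[K]_(n, d), regular_rep N n F & (F *m F^T) p x != 0.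
Proof.
move=> px pN; pose A := p |: N x.
have A_dom : dominating N x A.
  split=> [|i ix].
    by apply/subsetP => i; rewrite !inE => /predU1P[->//|/(N_lt N_dom)].
  by apply: leq_trans ((N_dom x).2 i ix) _; apply/subset_leq_card/setSI/subsetUr.
(* The strict bound on [#|N x|] leaves room for [p]. *)
have A_card : (#|A| <= d)%N by rewrite cardsU1 pN add1n.
have [F rF [fA fN]] := regular_rep_meet (N_lt N_dom)
  (@curve_open_gram_free K n d A A) (@curve_open_gram_free K n d (N x) (N x))
  (free_rep N_dom K A_dom A_dom (leqnn _) A_card)
  (free_rep N_dom K (N_dom x) (N_dom x) (leqnn _) (ltnW (N_card x))).
have [z zN zF|v [vp vN]] := @exists_orth K n d (N x) F (row p F).
  have : z - delta_mx 0 p = 0.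
    apply: (gram_free_indep fA) => [i|]; last by rewrite mulmxBl zF -rowE subrr.
    by rewrite !inE negb_or !mxE => /andP[/negPf -> /zN ->]; rewrite andbF subr0.
  move/rowP/(_ p); rewrite !mxE !eqxx zN // sub0r => /eqP.
  by rewrite oppr_eq0 oner_eq0.
(* The vertices after [x] are added; zeroing their rows does not affect the product of rows [p] and
   [x]. *)
have [|w E xw|| E rE Epx] := @regular_rep_extend x.+1 (n - x.+1)
    (fun F => (F *m F^T) p x != 0).
- exact: curve_open_gram_neq0.
- rewrite gram_set_row //; apply: contraTneq xw => <-; last by rewrite ltnn.
  by rewrite -leqNgt ltnW // ltnS ltnW.
- exists (set_row x v F); first exact: (regular_rep_set_row (N_lt N_dom)).
  by rewrite gram_set_row_w //; apply: contraTneq px => ->; rewrite ltnn.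
by exists E => //; rewrite subnKC in rE.
Qed.

Lemma faithful_rep : exists F : 'M[K]_(n, d),
  forall i j : 'I_n, (i < j)%N -> ((F *m F^T) i j == 0) = (i \in N j).
Proof.
(* The condition is vacuous for the other pairs, so the induction can run over all pairs. *)
pose ok (q : 'I_n * 'I_n) (F : 'M[K]_(n, d)) :=
  (q.1 < q.2)%N && (q.1 \notin N q.2) -> (F *m F^T) q.1 q.2 != 0.
have ok_open q : curve_open (ok q).
  move=> Phi t; rewrite /ok; case: (_ && _) => [/(_ isT) qt|_].
    have [p p0 pO] := curve_open_gram_neq0 qt.
    by exists p => // u /pO.
  by exists 1; rewrite ?oner_neq0.
have [F [oF _] okF] : exists2 F, regular_rep N n F &
    forall q, q \in enum {: 'I_n * 'I_n} -> ok q F.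
  elim: (enum _) => [|q s IH].
    have [|||F rF _] := @regular_rep_extend 0 n (fun=> True); last by exists F.
    - by move=> Phi t _; exists 1; rewrite ?oner_neq0.
    - by [].
    - by exists 0.
  have okq : exists2 F, regular_rep N n F & ok q F.
    have [/andP[qlt qN]|q_bad] := boolP ((q.1 < q.2)%N && (q.1 \notin N q.2)).
      by have [F rF Fq] := edge_rep qlt qN; exists F.
    by case: IH => F rF _; exists F => // q_ok; rewrite q_ok in q_bad.
  have [F rF [Fq Fs]] := regular_rep_meet (N_lt N_dom) (ok_open q)
    (curve_open_all ok_open) okq IH.
  by exists F => // r; rewrite inE => /predU1P[->|/Fs].
exists F => i j ij; apply/idP/idP => [|iN]; last by rewrite oF.
by apply: contraLR => iN; apply: (okF (i, j)); rewrite ?mem_enum //= ij.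
Qed.

End FaithfulRep.

(** * Maximum adjacency orders and the delta bound *)

Lemma max_adjacency_order n (e : rel 'I_n) : exists s : {perm 'I_n},
  forall i j : 'I_n, (i <= j)%N ->
    (#|[set k : 'I_n | (k < i)%N && ~~ e (s k) (s i)]| <=
     #|[set k : 'I_n | (k < i)%N && ~~ e (s k) (s j)]|)%N.
Proof.
pose c (s : {perm 'I_n}) m x := #|[set k : 'I_n | (k < m)%N && ~~ e (s k) x]|.
suff prefix_order m : exists s : {perm 'I_n}, forall i j : 'I_n,
    (i < m)%N -> (i <= j)%N -> (c s i (s i) <= c s i (s j))%N.
  by have [s sP] := prefix_order n; exists s => i j; apply: sP.
elim: m => [|m [s IH]]; first by exists 1%g.
have [nm|mn] := leqP n m.
  by exists s => i j _; apply: IH; apply: leq_trans nm.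
pose w : 'I_n := Ordinal mn.
(* Greedy choice: among the positions from [w] on, [v] holds a vertex with the fewest non-neighbors
   already placed; it is swapped into position [w]. *)
have [v wv vmin] := @arg_minnP _ w (fun j => w <= j)%N (fun j => c s w (s j)) (leqnn _).
have fixlt (k : 'I_n) : (k < w)%N -> tperm w v k = k.
  move=> kw; apply: tpermD; first by apply: contraTneq kw => ->; rewrite ltnn.
  by apply: contraTneq kw => <-; rewrite -leqNgt.
have gew (k : 'I_n) : (w <= k)%N -> (w <= tperm w v k)%N.
  by case: tpermP => // ->.
have cE i x : (i <= w)%N -> c (tperm w v * s)%g i x = c s i x.
  move=> iw; apply: eq_card => k; rewrite !inE; case: ltnP => //= ki.
  by rewrite permM fixlt // (leq_trans ki).
exists (tperm w v * s)%g => i j; rewrite ltnS => iw ij; rewrite !cE // !permM.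
case: (ltnP i w) => [im|mi].
  rewrite fixlt //; apply: IH => //.
  by case: (ltnP j w) => [/fixlt ->//|/gew]; apply: leq_trans; apply: ltnW.
have -> : i = w by apply: val_inj; apply/eqP; rewrite eqn_leq iw.
by rewrite tpermL; apply: vmin; apply: gew; rewrite (leq_trans mi).
Qed.

Lemma graph_faithful_rep (K : numFieldType) n (G : sgraph n) :
  exists F : 'M[K]_(n, n - min_degree G),
    forall i j : 'I_n, i != j -> ((F *m F^T) i j != 0) = G i j.
Proof.
have [s sP] := max_adjacency_order G.
pose N (j : 'I_n) := [set i : 'I_n | (i < j)%N && ~~ G (s i) (s j)].
(* The order compares [s i] and [s j] over the same earlier positions, and the non-neighbors of
   [s j] before [i] are those of [N j] before [i]. *)
have N_dom (j : 'I_n) : dominating N j (N j).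
  split=> [|i ij]; first by apply/subsetP => i; rewrite !inE => /andP[].
  apply: leq_trans (sP i j (ltnW ij)) (subset_leq_card _).
  by apply/subsetP => k; rewrite !inE => /andP[ki ->]; rewrite ki (ltn_trans ki).
(* The neighbors of [s j], the image of [N j] and [s j] itself are pairwise disjoint. *)
have N_card (j : 'I_n) : (#|N j| < n - min_degree G)%N.
  have n_gt0 : (0 < n)%N by apply: leq_ltn_trans (ltn_ord j).
  rewrite ltn_subRL; apply: leq_ltn_trans (_ : degree G (s j) + #|N j| < _)%N.
    by rewrite leq_add2r; apply: (min_degreeP G n_gt0).2.
  rewrite -(card_imset _ (@perm_inj _ s)) /degree.
  have disj : [disjoint [set k | G (s j) k] & s @: N j].
    rewrite disjoint_subset; apply/subsetP => k; rewrite !inE => Gk.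
    apply/negP => /imsetP[i + E]; rewrite inE => /andP[_ nG].
    by rewrite -E adj_sym Gk in nG.
  have -> : (#|[set k | G (s j) k]| + #|s @: N j| =
             #|[set k | G (s j) k] :|: s @: N j|)%N.
    by rewrite cardsU (disjoint_setI0 disj) cards0 subn0.
  rewrite -[X in (_ < X)%N](card_ord n) -cardsT; apply/proper_card/properP.
  split; first exact: subsetT.
  exists (s j); rewrite ?inE // adj_irr /=; apply/negP => /imsetP[i + /perm_inj E].
  by rewrite inE -E ltnn.
have [F FP] := faithful_rep K N_dom N_card.
exists (row_perm s^-1%g F) => i j ij.
pose a := s^-1%g i; pose b := s^-1%g j.
have -> : (row_perm s^-1%g F *m (row_perm s^-1%g F)^T) i j = (F *m F^T) a b.
  by rewrite !mxE; apply: eq_bigr => k _; rewrite !mxE.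
have -> : G i j = G (s a) (s b) by rewrite !permKV.
have : a != b by rewrite (inj_eq perm_inj).
rewrite neq_ltn => /orP[ab|ba].
  by rewrite FP // inE ab negbK.
by rewrite gram_sym FP // inE ba negbK adj_sym.
Qed.

(** As [theta] fixes the entries of [B], the bilinear Gram matrix is also the Hermitian one, hence
    positive semidefinite. *)
Lemma gram_Splus (F : numFieldType) (theta : {rmorphism F -> F}) n d
    (G : sgraph n) (B : 'M[F]_(n, d)) :
  (forall z, 0 <= theta z * z) -> map_mx theta B = B ->
  (forall i j : 'I_n, i != j -> ((B *m B^T) i j != 0) = G i j) ->
  Splus theta G (B *m B^T).
Proof.
move=> theta_ge0 BE BG; have BTE : map_mx theta B^T = B^T by rewrite -map_trmx BE.
split=> //; split=> [|x].
  rewrite qualifE /= expr0 scale1r; apply/eqP.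
  by rewrite trmx_mul trmxK map_mxM BE BTE.
rewrite mulmxA -mulmxA.
have -> : map_mx theta x^T *m B = map_mx theta (B^T *m x)^T.
  by rewrite trmx_mul trmxK map_mxM BE.
by rewrite !mxE sumr_ge0 // => k _; rewrite !mxE.
Qed.

Theorem corollary6p5 (R : realType) (n : nat) (G : sgraph n)
    (G_connected : connected_graph G) :
  (msr_real R G <= n - min_degree G)%N /\
  (msr_complex R G <= n - min_degree G)%N.
Proof.
have [F FG] := graph_faithful_rep R G.
have rank_gram (K : fieldType) d (B : 'M[K]_(n, d)) : (\rank (B *m B^T) <= d)%N.
  exact: leq_trans (mxrankM_maxl _ _) (rank_leq_col _).
split.
  rewrite /msr_real; case: ex_minnP => k _ k_min.
  apply: leq_trans (k_min _ _) (rank_gram _ _ F).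
  apply/boolp.asboolP; exists (F *m F^T); split=> //.
  apply: gram_Splus => //; last by apply/matrixP => i j; rewrite mxE.
  by move=> z; rewrite /= -expr2 sqr_ge0.
(* The real vectors serve again, since conjugation fixes them. *)
pose B := map_mx (real_complex R) F.
rewrite /msr_complex; case: ex_minnP => k _ k_min.
apply: leq_trans (k_min _ _) (rank_gram _ _ B).
apply/boolp.asboolP; exists (B *m B^T); split=> //.
apply: gram_Splus => [z||i j ij].
- by rewrite mulrC mul_conjC_ge0.
- by apply/matrixP => i j; rewrite !mxE; exact: conjc_real.
by rewrite map_trmx -map_mxM mxE fmorph_eq0 FG.
Qed.
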